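(* Let $\mathsf A$ be a category. There is a one-to-one correspondence between unital bimodule monoids $(\rho,\gamma,\eta)$ with $\rho:\mathsf A^{op}\times\mathsf A\to\mathrm{Set}$ and categories $\mathcal X$ equipped with an identity-on-objects functor $\imath:\mathsf A\to\mathcal X$.
   Context: An $\mathsf A$-$\mathsf A$ bimodule in $\mathrm{Set}$ is a functor $\rho:\mathsf A^{op}\times\mathsf A\to\mathrm{Set}$. The plethysm product is $(\rho_1\,\square\,\rho_2)(A,C)=\int^{B\in\mathsf A}\rho_1(A,B)\times\rho_2(B,C)$; it is a monoidal product on bimodules with unit $\tilde\rho_{\mathsf A}=\mathrm{Hom}_{\mathsf A}(-,-)$. A unital bimodule monoid is a bimodule $\rho$ with an associative natural transformation $\gamma:\rho\,\square\,\rho\Rightarrow\rho$ and a natural transformation $\eta:\tilde\rho_{\mathsf A}\Rightarrow\rho$ satisfying the left and right unit laws, i.e. $\gamma\circ(\mathrm{id}\,\square\,\eta)$ and $\gamma\circ(\eta\,\square\,\mathrm{id})$ are the unit isomorphisms. The correspondence is given as follows. To $\imath:\mathsf A\to\mathcal X$ one associates $\rho_{\mathcal X}(X,Y)=\mathrm{Hom}_{\mathcal X}(X,Y)$ with action $\phi\mapsto\imath(\tau)\circ\phi\circ\imath(\sigma)$ for morphisms $\sigma:X'\to X$ and $\tau:Y\to Y'$ of $\mathsf A$, with $\gamma$ induced by composition in $\mathcal X$ and $\eta$ given by $\imath$ on hom-sets. To $(\rho,\gamma,\eta)$ one associates the category $\mathcal X(\rho,\gamma)$ with the objects of $\mathsf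 A$, $\mathrm{Hom}(A,B)=\rho(A,B)$, composition $\rho(A,B)\times\rho(B,C)\to(\rho\,\square\,\rho)(A,C)\xrightarrow{\gamma}\rho(A,C)$, and the functor $\imath$ given on morphisms by $\eta$. *)

(* Defs.v *)
From Stdlib Require Import Relations.
From Stdlib Require Import FunctionalExtensionality PropExtensionality.
From Stdlib Require Import ProofIrrelevance ClassicalEpsilon.

(** * Categories and functors *)

(** Category structures on a fixed type of objects, so that "having the same
    objects as [A]" is a matter of typing. *)
Record category_on (O : Type) := {
  hom : O -> O -> Type;
  idm : forall a, hom a a;
  comp : forall {a b c}, hom b c -> hom a b -> hom a c;
  comp_idl : forall a b (f : hom a b), comp (idm b) f = f;
  comp_idr : forall a b (f : hom a b), comp f (idm a) = f;
  comp_assoc : forall a b c d (h : hom c d) (g : hom b c) (f : hom a b),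
    comp h (comp g f) = comp (comp h g) f
}.
Arguments hom {O} _ _ _.
Arguments idm {O} _ _.
Arguments comp_idl {O} _ _ _ _.
Arguments comp_idr {O} _ _ _ _.
Arguments comp_assoc {O} _ _ _ _ _ _ _ _.
Arguments comp {O} _ {_ _ _} _ _.

Record category := { ob :> Type; cat :> category_on ob }.

Definition op_cat {O : Type} (C : category_on O) : category_on O := {|
  hom := fun a b => hom C b a;
  idm := fun a => idm C a;
  comp := fun a b c g f => comp C f g;
  comp_idl := fun a b f => comp_idr C b a f;
  comp_idr := fun a b f => comp_idl C b a f;
  comp_assoc := fun a b c d h g f => eq_sym (comp_assoc C d c b a f g h)
|}.

Definition prod_cat {O P : Type} (C : category_on O) (D : category_on P) :
  category_on (O * P).
Proof.
  refine {|
    hom := fun x y => (hom C (fst x) (fst y) * hom D (snd x) (snd y))%type;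
    idm := fun x => (idm C (fst x), idm D (snd x));
    comp := fun x y z g f =>
      (comp C (fst g) (fst f), comp D (snd g) (snd f)) |}.
  - intros x y [f g]; simpl; now rewrite !comp_idl.
  - intros x y [f g]; simpl; now rewrite !comp_idr.
  - intros x y z t h g f; simpl; now rewrite !comp_assoc.
Defined.

(** Functors with prescribed object map [F]. *)
Record functor_over {O P : Type} (C : category_on O) (D : category_on P)
    (F : O -> P) := {
  fmap : forall a b, hom C a b -> hom D (F a) (F b);
  fmap_id : forall a, fmap a a (idm C a) = idm D (F a);
  fmap_comp : forall a b c (g : hom C b c) (f : hom C a b),
    fmap a c (comp C g f) = comp D (fmap b c g) (fmap a b f)
}.
Arguments fmap {O P C D F} _ {a b} _.
Arguments fmap_id {O P C D F} _ _.
Arguments fmap_comp {O P C D F} _ {a b c} _ _.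

(** Functors to the category of sets, a set being a [Type]. *)
Record set_functor {O : Type} (C : category_on O) := {
  sob :> O -> Type;
  smap : forall x y, hom C x y -> sob x -> sob y;
  smap_id : forall x (u : sob x), smap x x (idm C x) u = u;
  smap_comp : forall x y z (g : hom C y z) (f : hom C x y) (u : sob x),
    smap x z (comp C g f) u = smap y z g (smap x y f u)
}.
Arguments sob {O C} _ _.
Arguments smap_id {O C} _ _ _.
Arguments smap_comp {O C} _ {x y z} _ _ _.
Arguments smap {O C} _ {x y} _ _.

Record nat_trans {O : Type} {C : category_on O} (F G : set_functor C) := {
  nt :> forall x, F x -> G x;
  nt_natural : forall x y (f : hom C x y) (u : F x),
    nt y (smap F f u) = smap G f (nt x u)
}.
Arguments nt_natural {O C F G} _ {x y} _ _.
Arguments nt {O C F G} _ {x} _.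

Set Implicit Arguments.

Definition nt_id (O : Type) (C : category_on O) (F : set_functor C) :
  nat_trans F F := {|
  nt := fun x u => u;
  nt_natural := fun x y f u => eq_refl
|}.

Definition nt_comp (O : Type) (C : category_on O) (F G H : set_functor C)
    (t : nat_trans G H) (s : nat_trans F G) : nat_trans F H.
Proof.
  refine {| nt := fun x u => nt t (nt s u) |}.
  intros x y f u; now rewrite !nt_natural.
Defined.

(** * Bimodules *)

Definition bimodule (A : category) := set_functor (prod_cat (op_cat A) A).

(** The action of [s : a' -> a] and [t : b -> b'] on [R (a, b)]. *)
Definition act {A : category} (R : bimodule A) {a a' b b' : A}
    (s : hom A a' a) (t : hom A b b') (u : R (a, b)) : R (a', b') :=
  @smap _ _ R (a, b) (a', b') (s, t) u.

Lemma act_id (A : category) (R : bimodule A) (a b : A) (u : R (a, b)) :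
  act R (idm A a) (idm A b) u = u.
Proof. exact (smap_id R (a, b) u). Qed.

Lemma act_act (A : category) (R : bimodule A) (a a' a'' b b' b'' : A)
    (s : hom A a' a) (s' : hom A a'' a') (t : hom A b b') (t' : hom A b' b'')
    (u : R (a, b)) :
  act R s' t' (act R s t u) = act R (comp A s s') (comp A t' t) u.
Proof.
  exact (eq_sym (@smap_comp _ _ R (a, b) (a', b') (a'', b'')
                   (s', t') (s, t) u)).
Qed.

Lemma nt_act (A : category) (R S : bimodule A) (n : nat_trans R S)
    (a a' b b' : A) (s : hom A a' a) (t : hom A b b') (u : R (a, b)) :
  nt n (act R s t u) = act S s t (nt n u).
Proof. exact (@nt_natural _ _ _ _ n (a, b) (a', b') (s, t) u). Qed.

Definition hom_bimodule (A : category) : bimodule A.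
Proof.
  refine {|
    sob := (fun x => hom A (fst x) (snd x)) : A * A -> Type;
    smap := fun x y (f : hom (prod_cat (op_cat A) A) x y) u =>
      comp A (snd f) (comp A u (fst f)) |}.
  - intros x u; simpl; now rewrite comp_idr, comp_idl.
  - intros x y z g f u; simpl; now rewrite !comp_assoc.
Defined.

Lemma act_hom (A : category) (a a' b b' : A) (s : hom A a' a)
    (t : hom A b b') (f : hom A a b) :
  act (hom_bimodule A) s t f = comp A t (comp A f s).
Proof. reflexivity. Qed.

(** * Coends

    The coend of [P : A^op x A -> Set] is the quotient of the disjoint union
    of the [P (b, b)] by the equivalence relation generated by
    [P (f, 1) p ~ P (1, f) p] for [f : b -> b'] and [p] in [P (b', b)].  Its
    elements are represented by equivalence classes. *)

Section Coend.

Variables (A : category) (P : bimodule A).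

Inductive coend_step : relation {b : A & P (b, b)} :=
| Coend_step : forall (b b' : A) (f : hom A b b') (p : P (b', b)),
    coend_step (existT (fun b : A => P (b, b)) b (act P f (idm A b) p))
               (existT (fun b : A => P (b, b)) b' (act P (idm A b') f p)).

Definition coend : Type :=
  {K : {b : A & P (b, b)} -> Prop |
    exists t, K = clos_refl_sym_trans _ coend_step t}.

Definition coend_in (b : A) (p : P (b, b)) : coend :=
  exist _ (clos_refl_sym_trans _ coend_step
             (existT (fun b : A => P (b, b)) b p))
    (ex_intro _ _ eq_refl).

Lemma coend_in_surj (k : coend) :
  exists (b : A) (p : P (b, b)), k = coend_in b p.
Proof.
  destruct k as [K [[b p] ->]]; exists b, p.
  unfold coend_in; f_equal; apply proof_irrelevance.
Qed.

Lemma coend_glue (b b' : A) (f : hom A b b') (p : P (b', b)) :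
  coend_in b (act P f (idm A b) p) = coend_in b' (act P (idm A b') f p).
Proof.
  apply eq_sig_hprop; [intros; apply proof_irrelevance | simpl].
  apply functional_extensionality; intro t.
  apply propositional_extensionality; split; intro H.
  - eapply rst_trans; [apply rst_sym, rst_step, Coend_step | exact H].
  - eapply rst_trans; [apply rst_step, Coend_step | exact H].
Qed.

Variables (T : Type) (g : forall b : A, P (b, b) -> T).
Hypothesis g_glue : forall (b b' : A) (f : hom A b b') (p : P (b', b)),
  g b (act P f (idm A b) p) = g b' (act P (idm A b') f p).

Lemma coend_rec_exists (k : coend) :
  exists v : T, exists (b : A) (p : P (b, b)), k = coend_in b p /\ v = g b p.
Proof. destruct (coend_in_surj k) as (b & p & ->); eauto. Qed.

(** A value of [g] at a chosen representative; by [coend_rec_in] it is the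
    map induced by [g] when [g] is compatible with the gluing. *)
Definition coend_rec (k : coend) : T :=
  proj1_sig (constructive_indefinite_description _ (coend_rec_exists k)).

Lemma coend_rec_in (b : A) (p : P (b, b)) :
  coend_rec (coend_in b p) = g b p.
Proof.
  unfold coend_rec.
  destruct (constructive_indefinite_description _ _)
    as (v & b' & p' & E & ->); simpl.
  assert (H : clos_refl_sym_trans _ coend_step
                (existT (fun b : A => P (b, b)) b' p')
                (existT (fun b : A => P (b, b)) b p)).
  { apply (f_equal (@proj1_sig _ _)) in E; simpl in E.
    rewrite <- E; apply rst_refl. }
  change (g (projT1 (existT (fun b : A => P (b, b)) b' p'))
            (projT2 (existT (fun b : A => P (b, b)) b' p'))
          = g (projT1 (existT (fun b : A => P (b, b)) b p))
            (projT2 (existT (fun b : A => P (b, b)) b p))).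
  induction H as [? ? [c c' f q]| | |]; simpl; congruence || auto.
Qed.

End Coend.

Arguments coend_in {A P} b p.
Arguments coend_in_surj {A P} k.
Arguments coend_glue {A P b b'} f p.
Arguments coend_rec {A P T} g k.
Arguments coend_rec_in {A P T} g g_glue b p.

(** * Plethysm product *)

Definition integrand (A : category) (R S : bimodule A) (a c : A) : bimodule A.
Proof.
  refine {|
    sob := (fun x => (R (a, snd x) * S (fst x, c))%type) : A * A -> Type;
    smap := fun x y (f : hom (prod_cat (op_cat A) A) x y) p =>
      (act R (idm A a) (snd f) (fst p), act S (fst f) (idm A c) (snd p)) |}.
  - intros [b b'] [u v]; simpl; now rewrite !act_id.
  - intros x y z g f u; simpl; rewrite !act_act; now rewrite !comp_idl.
Defined.

Definition pleth_ob (A : category) (R S : bimodule A) (x : A * A) : Type :=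
  coend (integrand R S (fst x) (snd x)).

(** The class of [(u, v)]. *)
Definition pleth_in (A : category) (R S : bimodule A) (a b c : A)
    (u : R (a, b)) (v : S (b, c)) : pleth_ob R S (a, c) :=
  @coend_in A (integrand R S a c) b (u, v).

Lemma pleth_surj (A : category) (R S : bimodule A) (a c : A)
    (k : pleth_ob R S (a, c)) :
  exists (b : A) (u : R (a, b)) (v : S (b, c)), k = pleth_in R S a b c u v.
Proof.
  destruct (coend_in_surj k) as (b & [u v] & ->); now exists b, u, v.
Qed.

Arguments pleth_surj {A} R S {a c} k.

Lemma pleth_glue (A : category) (R S : bimodule A) (a b b' c : A)
    (f : hom A b b') (u : R (a, b)) (v : S (b', c)) :
  pleth_in R S a b c u (act S f (idm A c) v)
  = pleth_in R S a b' c (act R (idm A a) f u) v.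
Proof.
  generalize (@coend_glue A (integrand R S a c) b b' f (u, v)).
  unfold act at 1 2; simpl; now rewrite !act_id.
Qed.

Definition pleth_rec (A : category) (R S : bimodule A) (a c : A) (T : Type)
    (g : forall b : A, R (a, b) -> S (b, c) -> T) (k : pleth_ob R S (a, c)) :
  T :=
  @coend_rec A (integrand R S a c) T (fun b p => g b (fst p) (snd p)) k.

Arguments pleth_rec {A} R S {a c T} g k.

Lemma pleth_rec_in (A : category) (R S : bimodule A) (a c : A) (T : Type)
    (g : forall b : A, R (a, b) -> S (b, c) -> T)
    (g_glue : forall (b b' : A) (f : hom A b b') u v,
       g b u (act S f (idm A c) v) = g b' (act R (idm A a) f u) v)
    (b : A) (u : R (a, b)) (v : S (b, c)) :
  pleth_rec R S g (pleth_in R S a b c u v) = g b u v.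
Proof.
  unfold pleth_rec, pleth_in; rewrite coend_rec_in; [easy|].
  intros d d' f [x y]; unfold act at 1 2 3 4; simpl; rewrite !act_id.
  apply g_glue.
Qed.

(** [(s, t)] sends the class of [(u, v)] to that of
    [(act s 1 u, act 1 t v)]. *)
Definition pleth_map (A : category) (R S : bimodule A) (x y : A * A)
    (f : hom (prod_cat (op_cat A) A) x y) (k : pleth_ob R S x) :
  pleth_ob R S y :=
  @pleth_rec A R S (fst x) (snd x) (pleth_ob R S y)
    (fun b u v => pleth_in R S (fst y) b (snd y)
       (act R (fst f) (idm A b) u) (act S (idm A b) (snd f) v)) k.

Arguments pleth_map {A} R S {x y} f k.

Lemma pleth_map_in (A : category) (R S : bimodule A) (a a' b c c' : A)
    (s : hom A a' a) (t : hom A c c') (u : R (a, b)) (v : S (b, c)) :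
  @pleth_map A R S (a, c) (a', c') (s, t) (pleth_in R S a b c u v)
  = pleth_in R S a' b c' (act R s (idm A b) u) (act S (idm A b) t v).
Proof.
  unfold pleth_map; simpl; rewrite pleth_rec_in; [easy|].
  intros d d' f x y.
  transitivity (pleth_in R S a' d c' (act R s (idm A d) x)
                  (act S f (idm A c') (act S (idm A d') t y))).
  - f_equal; rewrite !act_act; now rewrite !comp_idl, !comp_idr.
  - rewrite pleth_glue; f_equal; rewrite !act_act.
    now rewrite !comp_idl, !comp_idr.
Qed.

Definition pleth (A : category) (R S : bimodule A) : bimodule A.
Proof.
  refine {| sob := pleth_ob R S; smap := @pleth_map A R S |}.
  - intros [a c] k; destruct (pleth_surj R S k) as (b & u & v & ->).
    refine (eq_trans (@pleth_map_in A R S a a b c c _ _ u v) _).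
    now rewrite !act_id.
  - intros [a c] [a' c'] [a'' c''] [s' t'] [s t] k.
    destruct (pleth_surj R S k) as (b & u & v & ->).
    refine (eq_trans (@pleth_map_in A R S a a'' b c c'' _ _ u v) _).
    rewrite !pleth_map_in, !act_act; simpl; now rewrite !comp_idl.
Defined.

Definition pleth_hom (A : category) (R R' S S' : bimodule A)
    (m : nat_trans R R') (n : nat_trans S S') :
  nat_trans (pleth R S) (pleth R' S').
Proof.
  refine {| nt := (fun x => @pleth_rec A R S (fst x) (snd x) (pleth_ob R' S' x)
    (fun b u v =>
       pleth_in R' S' (fst x) b (snd x) (nt m u) (nt n v)))
    : forall x : A * A, pleth R S x -> pleth R' S' x |}.
  assert (glue : forall (a c b b' : A) (f : hom A b b')
      (u : R (a, b)) (v : S (b', c)),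
    pleth_in R' S' a b c (nt m u) (nt n (act S f (idm A c) v))
    = pleth_in R' S' a b' c (nt m (act R (idm A a) f u)) (nt n v)).
  { intros; rewrite !nt_act; apply pleth_glue. }
  intros [a c] [a' c'] [s t] k.
  destruct (pleth_surj R S k) as (b & u & v & ->).
  change (smap (pleth R S) ?h ?x) with (pleth_map R S h x).
  change (smap (pleth R' S') ?h ?x) with (pleth_map R' S' h x).
  rewrite pleth_map_in; simpl.
  rewrite !pleth_rec_in by apply glue.
  rewrite pleth_map_in; now rewrite !nt_act.
Defined.

(** [((u, v), w) |-> (u, (v, w))]. *)
Definition associator (A : category) (R S T : bimodule A) :
  nat_trans (pleth (pleth R S) T) (pleth R (pleth S T)).
Proof.
  pose (in1 := fun (a c d : A) (w : T (c, d)) (b : A) (u : R (a, b))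
                   (v : S (b, c)) =>
    pleth_in R (pleth S T) a b d u (pleth_in S T b c d v w)).
  pose (in2 := fun (a d c : A) (k : pleth R S (a, c)) (w : T (c, d)) =>
    pleth_rec R S (in1 a c d w) k).
  refine {| nt := (fun x =>
      @pleth_rec A (pleth R S) T (fst x) (snd x)
        (pleth R (pleth S T) x) (in2 (fst x) (snd x)))
    : forall x : A * A, pleth (pleth R S) T x -> pleth R (pleth S T) x |}.
  assert (glue1 : forall (a c d : A) (w : T (c, d)) (b b' : A)
      (f : hom A b b') (u : R (a, b)) (v : S (b', c)),
    in1 a c d w b u (act S f (idm A c) v)
    = in1 a c d w b' (act R (idm A a) f u) v).
  { intros; unfold in1; rewrite <- pleth_glue; f_equal.
    unfold act at 2; simpl; rewrite pleth_map_in; now rewrite act_id. }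
  assert (glue2 : forall (a d c c' : A) (f : hom A c c')
      (k : pleth R S (a, c)) (w : T (c', d)),
    in2 a d c k (act T f (idm A d) w)
    = in2 a d c' (act (pleth R S) (idm A a) f k) w).
  { intros; destruct (pleth_surj R S k) as (b & u & v & ->).
    unfold in2, act at 2; simpl; rewrite pleth_map_in.
    rewrite !pleth_rec_in by apply glue1; unfold in1.
    now rewrite pleth_glue, act_id. }
  intros [a d] [a' d'] [s t] k.
  destruct (pleth_surj (pleth R S) T k) as (c & k' & w & ->).
  destruct (pleth_surj R S k') as (b & u & v & ->).
  change (smap (pleth ?X ?Y) ?h ?x) with (pleth_map X Y h x).
  rewrite pleth_map_in; simpl.
  rewrite !pleth_rec_in by apply glue2.
  unfold in2, act at 1; simpl; rewrite pleth_map_in.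
  rewrite !pleth_rec_in by apply glue1; unfold in1.
  rewrite pleth_map_in; f_equal.
  symmetry; unfold act at 1; simpl; now rewrite pleth_map_in.
Defined.

(** [(f, v) |-> act f 1 v]. *)
Definition left_unitor (A : category) (R : bimodule A) :
  nat_trans (pleth (hom_bimodule A) R) R.
Proof.
  refine {| nt := (fun '(a, c) =>
      pleth_rec (hom_bimodule A) R
        (fun (b : A) (f : hom A a b) (v : R (b, c)) =>
           act R f (idm A c) v))
    : forall x : A * A, pleth (hom_bimodule A) R x -> R x |}.
  assert (glue : forall (a c b b' : A) (f : hom A b b')
      (u : hom A a b) (v : R (b', c)),
    act R u (idm A c) (act R f (idm A c) v)
    = act R (act (hom_bimodule A) (idm A a) f u) (idm A c) v).
  { intros; rewrite act_act, act_hom.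
    now rewrite !comp_idr. }
  intros [a c] [a' c'] [s t] k.
  destruct (pleth_surj (hom_bimodule A) R k) as (b & u & v & ->).
  change (smap (pleth ?X ?Y) ?h ?x) with (pleth_map X Y h x).
  rewrite pleth_map_in.
  rewrite !pleth_rec_in by (intros; apply glue).
  change (smap R (s, t) ?x) with (act R s t x).
  rewrite !act_act, act_hom.
  now rewrite !comp_idl, !comp_idr.
Defined.

(** [(u, f) |-> act 1 f u]. *)
Definition right_unitor (A : category) (R : bimodule A) :
  nat_trans (pleth R (hom_bimodule A)) R.
Proof.
  refine {| nt := (fun '(a, c) =>
      pleth_rec R (hom_bimodule A)
        (fun (b : A) (u : R (a, b)) (f : hom A b c) =>
           act R (idm A a) f u))
    : forall x : A * A, pleth R (hom_bimodule A) x -> R x |}.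
  assert (glue : forall (a c b b' : A) (f : hom A b b')
      (u : R (a, b)) (v : hom A b' c),
    act R (idm A a) (act (hom_bimodule A) f (idm A c) v) u
    = act R (idm A a) v (act R (idm A a) f u)).
  { intros; rewrite act_act, act_hom.
    now rewrite !comp_idl. }
  intros [a c] [a' c'] [s t] k.
  destruct (pleth_surj R (hom_bimodule A) k) as (b & u & v & ->).
  change (smap (pleth ?X ?Y) ?h ?x) with (pleth_map X Y h x).
  rewrite pleth_map_in.
  rewrite !pleth_rec_in by (intros; apply glue).
  change (smap R (s, t) ?x) with (act R s t x).
  rewrite !act_act, act_hom.
  now rewrite !comp_idl, !comp_idr.
Defined.

(** * The two sides of the correspondence *)

Record unital_bimodule_monoid (A : category) := {
  rho : bimodule A;
  gamma : nat_trans (pleth rho rho) rho;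
  eta : nat_trans (hom_bimodule A) rho;
  gamma_assoc : forall x (k : pleth (pleth rho rho) rho x),
    nt (nt_comp gamma (pleth_hom gamma (nt_id rho))) k
    = nt (nt_comp gamma
            (nt_comp (pleth_hom (nt_id rho) gamma)
                     (associator rho rho rho))) k;
  gamma_unit_l : forall x (k : pleth (hom_bimodule A) rho x),
    nt (nt_comp gamma (pleth_hom eta (nt_id rho))) k
    = nt (left_unitor rho) k;
  gamma_unit_r : forall x (k : pleth rho (hom_bimodule A) x),
    nt (nt_comp gamma (pleth_hom (nt_id rho) eta)) k
    = nt (right_unitor rho) k
}.

(** Categories with an identity-on-objects functor from [A]. *)
Record category_under (A : category) := {
  target : category_on A;
  incl : functor_over A target (fun a => a)
}.

(** * The structure carried by each side, without its laws *)

Record monoid_structure (A : category) := MonoidStructure {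
  ms_carrier : A -> A -> Type;
  ms_act : forall a a' b b', hom A a' a -> hom A b b' ->
    ms_carrier a b -> ms_carrier a' b';
  (** [gamma] precomposed with the maps to the coend; this determines
      [gamma]. *)
  ms_gamma : forall a b c, ms_carrier a b -> ms_carrier b c -> ms_carrier a c;
  ms_eta : forall a b, hom A a b -> ms_carrier a b
}.

Definition structure_of_monoid (A : category) (M : unital_bimodule_monoid A) :
  monoid_structure A := {|
  ms_carrier := fun a b => rho M (a, b);
  ms_act := @act A (rho M);
  ms_gamma := fun a b c u v =>
    nt (gamma M) (pleth_in (rho M) (rho M) a b c u v);
  ms_eta := fun a b f => @nt _ _ _ _ (eta M) (a, b) f
|}.

Record under_structure (A : category) := UnderStructure {
  us_hom : A -> A -> Type;
  us_id : forall a, us_hom a a;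
  us_comp : forall a b c, us_hom b c -> us_hom a b -> us_hom a c;
  us_incl : forall a b, hom A a b -> us_hom a b
}.

Definition structure_of_category (A : category) (X : category_under A) :
  under_structure A := {|
  us_hom := hom (target X);
  us_id := idm (target X);
  us_comp := fun a b c g f => comp (target X) g f;
  us_incl := fun a b f => fmap (incl X) f
|}.

(** The bimodule [rho_X], on which [s] and [t] act by [f |-> i t o f o i s]. *)
Definition hom_structure (A : category) (X : category_under A) :
  monoid_structure A := {|
  ms_carrier := fun a b => hom (target X) a b;
  ms_act := fun a a' b b' s t f =>
    comp (target X) (fmap (incl X) t) (comp (target X) f (fmap (incl X) s));
  ms_gamma := fun a b c f g => comp (target X) g f;
  ms_eta := fun a b f => fmap (incl X) f
|}.

(** The category [X (rho, gamma)] with its functor from [A]. *)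
Definition category_structure (A : category) (M : unital_bimodule_monoid A) :
  under_structure A := {|
  us_hom := fun a b => rho M (a, b);
  us_id := fun a => @nt _ _ _ _ (eta M) (a, a) (idm A a);
  us_comp := fun a b c v u => nt (gamma M) (pleth_in (rho M) (rho M) a b c u v);
  us_incl := fun a b f => @nt _ _ _ _ (eta M) (a, b) f
|}.

(* Main.v *)
(** A map out of the coend [rho □ rho] is a family of maps
    [rho (a, b) -> rho (b, c) -> rho (a, c)] compatible with the gluing, so
    [gamma] amounts to a composition law and the axioms of a monoid become
    those of a category.  The unit laws say that composing with [eta s] is
    acting by [s]; hence [eta] is a functor and the action is recovered from
    it.  Both constructions are mutually inverse because an object on either
    side is determined by its structure without the laws. *)

Require Import Defs.
From Stdlib Require Import FunctionalExtensionality ProofIrrelevance.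

Set Implicit Arguments.

(** * Objects are determined by their structure *)

(** The types of [gamma] and [eta] mention the whole bimodule, so bimodules have to be identified
    before these maps can be compared. *)
Record bimodule_structure (A : category) := BimoduleStructure {
  bs_carrier : A -> A -> Type;
  bs_act : forall a a' b b', hom A a' a -> hom A b b' ->
    bs_carrier a b -> bs_carrier a' b'
}.

Definition structure_of_bimodule (A : category) (R : bimodule A) :
  bimodule_structure A :=
  BimoduleStructure A (fun a b => R (a, b)) (@act A R).

(** Rocq's pairs have no definitional eta rule, so [R x] and
    [R (fst x, snd x)] are only propositionally equal; the bimodule is first
    brought to a form in which they are convertible. *)
Lemma bimodule_normal_form (A : category) (R : bimodule A) :
  exists (B : bimodule_structure A) i c,
    R = @Build_set_functor _ (prod_cat (op_cat A) A)
          (fun x => bs_carrier B (fst x) (snd x))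
          (fun x y f => bs_act B (fst x) (fst y) (snd x) (snd y)
                          (fst f) (snd f)) i c.
Proof.
  destruct R as [S m i c].
  assert (ES : exists T : A -> A -> Type, S = fun x => T (fst x) (snd x)).
  { exists (fun a b => S (a, b)); extensionality x; now destruct x. }
  destruct ES as [T ->].
  assert (Em : exists n : forall a a' b b', hom A a' a -> hom A b b' ->
                 T a b -> T a' b',
    m = fun x y f => n (fst x) (fst y) (snd x) (snd y) (fst f) (snd f)).
  { exists (fun a a' b b' s t => m (a, b) (a', b') (s, t)).
    extensionality x; extensionality y; extensionality f.
    now destruct x, y, f. }
  destruct Em as [n ->].
  now exists (BimoduleStructure A T n), i, c.
Qed.

Lemma bimodule_ext (A : category) (R R' : bimodule A) :
  structure_of_bimodule R = structure_of_bimodule R' -> R = R'.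
Proof.
  destruct (bimodule_normal_form R) as ([T n] & i & c & ->).
  destruct (bimodule_normal_form R') as ([T' n'] & i' & c' & ->).
  intro E.
  change (BimoduleStructure A T n = BimoduleStructure A T' n') in E.
  (* The actions are typed over the carriers, so [injection] yields an equality of dependent pairs,
     which [inj_pair2] strips. *)
  injection E as -> E; apply inj_pair2 in E; subst n'.
  f_equal; apply proof_irrelevance.
Qed.

Lemma nat_trans_ext (O : Type) (C : category_on O) (F G : set_functor C)
    (s t : nat_trans F G) : (forall x u, @nt _ _ _ _ s x u = nt t u) -> s = t.
Proof.
  destruct s as [s Hs], t as [t Ht]; simpl; intro E.
  assert (s = t) as ->
    by (extensionality x; extensionality u; apply E).
  f_equal; apply proof_irrelevance.
Qed.

(** Every element of the coend is the class of a pair, so [gamma] is determined by its values on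
    such classes. *)
Lemma monoid_ext (A : category) (M N : unital_bimodule_monoid A) :
  structure_of_monoid M = structure_of_monoid N -> M = N.
Proof.
  destruct M as [R g e p q r], N as [R' g' e' p' q' r']; intro E.
  assert (R = R') as <-.
  { apply bimodule_ext.
    exact (f_equal (fun S => BimoduleStructure A _ (ms_act S)) E). }
  unfold structure_of_monoid in E; simpl in E.
  injection E as Eg Ee.
  apply inj_pair2 in Eg; apply inj_pair2 in Ee.
  assert (g = g') as <-.
  { apply nat_trans_ext; intros [a c] k.
    destruct (pleth_surj R R k) as (b & u & v & ->).
    exact (f_equal (fun h => h a b c u v) Eg). }
  assert (e = e') as <-.
  { apply nat_trans_ext; intros [a b] f.
    exact (f_equal (fun h => h a b f) Ee). }
  f_equal; apply proof_irrelevance.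
Qed.

Lemma category_under_ext (A : category) (X Y : category_under A) :
  structure_of_category X = structure_of_category Y -> X = Y.
Proof.
  destruct X as [[H i c l r s] [m mi mc]], Y as [[H' i' c' l' r' s'] [m' mi' mc']].
  intro E.
  change (UnderStructure A H i c m = UnderStructure A H' i' c' m') in E.
  injection E as -> Ei Ec Em.
  apply inj_pair2 in Ei; apply inj_pair2 in Ec; apply inj_pair2 in Em.
  subst i' c' m'.
  (* The type of the functor depends on the category with its laws, so these proofs are identified
     first. *)
  assert (l = l') as <- by apply proof_irrelevance.
  assert (r = r') as <- by apply proof_irrelevance.
  assert (s = s') as <- by apply proof_irrelevance.
  do 2 f_equal; apply proof_irrelevance.
Qed.

(** * From categories to monoids *)

Section MonoidOfCategory.

Variables (A : category) (X : category_under A).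

Definition under_bimodule : bimodule A.
Proof.
  refine {|
    sob := (fun x => hom (target X) (fst x) (snd x)) : A * A -> Type;
    smap := fun x y (f : hom (prod_cat (op_cat A) A) x y) u =>
      comp (target X) (fmap (incl X) (snd f))
        (comp (target X) u (fmap (incl X) (fst f))) |}.
  - intros x u; simpl; now rewrite !fmap_id, comp_idr, comp_idl.
  - intros x y z g f u; simpl; now rewrite !fmap_comp, !comp_assoc.
Defined.

Lemma act_under (a a' b b' : A) (s : hom A a' a) (t : hom A b b')
    (f : hom (target X) a b) :
  act under_bimodule s t f
  = comp (target X) (fmap (incl X) t)
      (comp (target X) f (fmap (incl X) s)).
Proof. reflexivity. Qed.

(** Both sides are v ∘ i(f) ∘ u; this is what lets composition descend to the coend. *)
Lemma under_comp_glue (a b b' c : A) (f : hom A b b')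
    (u : under_bimodule (a, b)) (v : under_bimodule (b', c)) :
  comp (target X) (act under_bimodule f (idm A c) v) u
  = comp (target X) v (act under_bimodule (idm A a) f u).
Proof.
  rewrite !act_under, !fmap_id, comp_idl, comp_idr.
  symmetry; apply comp_assoc.
Qed.

Definition under_gamma :
  nat_trans (pleth under_bimodule under_bimodule) under_bimodule.
Proof.
  refine {| nt := (fun x => @pleth_rec A under_bimodule under_bimodule
      (fst x) (snd x) (under_bimodule x)
      (fun b u v => comp (target X) v u))
    : forall x : A * A, pleth under_bimodule under_bimodule x ->
        under_bimodule x |}.
  intros [a c] [a' c'] [s t] k.
  destruct (pleth_surj under_bimodule under_bimodule k) as (b & u & v & ->).
  change (smap (pleth ?R ?S) ?h ?x) with (pleth_map R S h x).
  rewrite pleth_map_in; simpl.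
  rewrite !pleth_rec_in by (intros; apply under_comp_glue).
  (* Up to identities and bracketing, both sides are i(t) ∘ v ∘ u ∘ i(s). *)
  rewrite !fmap_id, comp_idl, comp_idr.
  now rewrite !comp_assoc.
Defined.

Lemma under_gamma_in (a b c : A) (u : hom (target X) a b)
    (v : hom (target X) b c) :
  nt under_gamma (pleth_in under_bimodule under_bimodule a b c u v)
  = comp (target X) v u.
Proof.
  simpl; rewrite pleth_rec_in; [easy | intros; apply under_comp_glue].
Qed.

Definition under_eta : nat_trans (hom_bimodule A) under_bimodule.
Proof.
  refine {| nt := (fun x f => fmap (incl X) f)
    : forall x : A * A, hom_bimodule A x -> under_bimodule x |}.
  intros x y f u; simpl; now rewrite !fmap_comp.
Defined.

End MonoidOfCategory.

(** * Values of the structural maps on classes of pairs and triples *)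

Lemma pleth_hom_in (A : category) (R R' S S' : bimodule A)
    (m : nat_trans R R') (n : nat_trans S S') (a b c : A)
    (u : R (a, b)) (v : S (b, c)) :
  @nt _ _ _ _ (pleth_hom m n) (a, c) (pleth_in R S a b c u v)
  = pleth_in R' S' a b c (nt m u) (nt n v).
Proof.
  simpl; rewrite pleth_rec_in; [easy|].
  intros; rewrite !nt_act; apply pleth_glue.
Qed.

Lemma associator_in (A : category) (R S T : bimodule A) (a b c d : A)
    (u : R (a, b)) (v : S (b, c)) (w : T (c, d)) :
  @nt _ _ _ _ (associator R S T) (a, d)
    (pleth_in (pleth R S) T a c d (pleth_in R S a b c u v) w)
  = pleth_in R (pleth S T) a b d u (pleth_in S T b c d v w).
Proof.
  assert (glue1 : forall (a c d : A) (w : T (c, d)) (b b' : A)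
      (f : hom A b b') (u : R (a, b)) (v : S (b', c)),
    pleth_in R (pleth S T) a b d u
      (pleth_in S T b c d (act S f (idm A c) v) w)
    = pleth_in R (pleth S T) a b' d (act R (idm A a) f u)
        (pleth_in S T b' c d v w)).
  { intros; rewrite <- pleth_glue; f_equal.
    unfold act at 2; simpl; rewrite pleth_map_in; now rewrite act_id. }
  simpl; rewrite !pleth_rec_in; [easy | apply glue1 |].
  (* Compatibility with the outer gluing is checked on a representative of the inner class. *)
  intros c1 c2 f k z; destruct (pleth_surj R S k) as (b' & x & y & ->).
  unfold act at 2; simpl; rewrite pleth_map_in.
  rewrite !pleth_rec_in by apply glue1.
  now rewrite pleth_glue, act_id.
Qed.

Lemma left_unitor_in (A : category) (R : bimodule A) (a b c : A)
    (f : hom A a b) (v : R (b, c)) :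
  @nt _ _ _ _ (left_unitor R) (a, c) (pleth_in (hom_bimodule A) R a b c f v)
  = act R f (idm A c) v.
Proof.
  simpl; rewrite pleth_rec_in; [easy|].
  intros; rewrite act_act, act_hom; now rewrite !comp_idr.
Qed.

Lemma right_unitor_in (A : category) (R : bimodule A) (a b c : A)
    (u : R (a, b)) (f : hom A b c) :
  @nt _ _ _ _ (right_unitor R) (a, c) (pleth_in R (hom_bimodule A) a b c u f)
  = act R (idm A a) f u.
Proof.
  simpl; rewrite pleth_rec_in; [easy|].
  intros; rewrite act_act, act_hom; now rewrite !comp_idl.
Qed.

Lemma nt_comp_eq (O : Type) (C : category_on O) (F G H : set_functor C)
    (t : nat_trans G H) (s : nat_trans F G) (x : O) (u : F x) :
  nt (nt_comp t s) u = nt t (nt s u).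
Proof. reflexivity. Qed.

Lemma nt_id_eq (O : Type) (C : category_on O) (F : set_functor C) (x : O)
    (u : F x) :
  nt (nt_id F) u = u.
Proof. reflexivity. Qed.

(** On classes, the associativity axiom is that of [target X], and the unit axioms follow from i(1)
    = 1 and an identity law. *)
Definition monoid_of_category (A : category) (X : category_under A) :
  unital_bimodule_monoid A.
Proof.
  refine {| rho := under_bimodule X; gamma := under_gamma X;
            eta := under_eta X |}.
  - intros [a d] k.
    destruct (pleth_surj _ _ k) as (c & k' & w & ->).
    destruct (pleth_surj _ _ k') as (b & u & v & ->).
    rewrite !nt_comp_eq, associator_in, !pleth_hom_in, !nt_id_eq.
    rewrite !under_gamma_in; apply comp_assoc.
  - intros [a c] k; destruct (pleth_surj _ _ k) as (b & f & v & ->).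
    rewrite nt_comp_eq, pleth_hom_in, left_unitor_in, nt_id_eq.
    rewrite under_gamma_in, act_under, fmap_id, comp_idl; reflexivity.
  - intros [a c] k; destruct (pleth_surj _ _ k) as (b & u & f & ->).
    rewrite nt_comp_eq, pleth_hom_in, right_unitor_in, nt_id_eq.
    rewrite under_gamma_in, act_under, fmap_id, comp_idr; reflexivity.
Defined.

Lemma structure_of_monoid_of_category (A : category) (X : category_under A) :
  structure_of_monoid (monoid_of_category X) = hom_structure X.
Proof.
  unfold structure_of_monoid, hom_structure; simpl; f_equal.
  extensionality a; extensionality b; extensionality c.
  extensionality u; extensionality v; exact (under_gamma_in X a b c u v).
Qed.

(** * From monoids to categories *)

Section CategoryOfMonoid.

Variables (A : category) (M : unital_bimodule_monoid A).

Definition mul {a b c : A} (u : rho M (a, b)) (v : rho M (b, c)) :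
  rho M (a, c) :=
  nt (gamma M) (pleth_in (rho M) (rho M) a b c u v).

Definition unit_map {a b : A} (f : hom A a b) : rho M (a, b) :=
  @nt _ _ _ _ (eta M) (a, b) f.

(** This is [gamma_assoc] evaluated at the class of ((u, v), w). *)
Lemma mul_assoc (a b c d : A) (u : rho M (a, b)) (v : rho M (b, c))
    (w : rho M (c, d)) :
  mul (mul u v) w = mul u (mul v w).
Proof.
  generalize (@gamma_assoc A M (a, d)
    (pleth_in (pleth (rho M) (rho M)) (rho M) a c d
       (pleth_in (rho M) (rho M) a b c u v) w)).
  now rewrite !nt_comp_eq, associator_in, !pleth_hom_in.
Qed.

(** The unit law at the class of (s, v). Together with its right-hand analogue it recovers the
    action from [gamma] and [eta]. *)
Lemma mul_unit_map_l (a b c : A) (s : hom A a b) (v : rho M (b, c)) :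
  mul (unit_map s) v = act (rho M) s (idm A c) v.
Proof.
  generalize (@gamma_unit_l A M (a, c)
    (pleth_in (hom_bimodule A) (rho M) a b c s v)).
  now rewrite nt_comp_eq, pleth_hom_in, left_unitor_in.
Qed.

Lemma mul_unit_map_r (a b c : A) (u : rho M (a, b)) (t : hom A b c) :
  mul u (unit_map t) = act (rho M) (idm A a) t u.
Proof.
  generalize (@gamma_unit_r A M (a, c)
    (pleth_in (rho M) (hom_bimodule A) a b c u t)).
  now rewrite nt_comp_eq, pleth_hom_in, right_unitor_in.
Qed.

Definition monoid_category : category_on A.
Proof.
  refine {| hom := fun a b => rho M (a, b);
            idm := fun a => unit_map (idm A a);
            comp := fun a b c v u => mul u v |}.
  (* As [comp] reverses the order of [mul], the left identity law comes from the right unit law. *)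
  - intros; rewrite mul_unit_map_r; apply act_id.
  - intros; rewrite mul_unit_map_l; apply act_id.
  - intros; apply mul_assoc.
Defined.

Definition monoid_functor : functor_over A monoid_category (fun a => a).
Proof.
  refine (@Build_functor_over A A A monoid_category (fun a => a)
            (@unit_map) (fun a => eq_refl) _).
  intros a b c g f; simpl.
  (* The product of [eta] f and [eta] g is g acting on [eta] f, which naturality of [eta] turns into
     [eta] (g ∘ f). *)
  rewrite mul_unit_map_r; unfold unit_map.
  rewrite <- nt_act, act_hom; now rewrite comp_idr.
Defined.

Definition category_of_monoid : category_under A :=
  {| target := monoid_category; incl := monoid_functor |}.

Lemma structure_of_category_of_monoid :
  structure_of_category category_of_monoid = category_structure M.
Proof. reflexivity. Qed.

Lemma hom_structure_category_of_monoid :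
  hom_structure category_of_monoid = structure_of_monoid M.
Proof.
  unfold hom_structure, structure_of_monoid; simpl; f_equal.
  extensionality a; extensionality a'; extensionality b; extensionality b'.
  extensionality s; extensionality t; extensionality u.
  (* Multiplying by [eta] s on the left and [eta] t on the right acts by s and then by t, hence by
     the pair (s, t). *)
  rewrite mul_unit_map_l, mul_unit_map_r, act_act.
  now rewrite !comp_idr.
Qed.

End CategoryOfMonoid.

(** * The round trip from categories, and the bijection *)

Lemma category_structure_monoid_of_category (A : category)
    (X : category_under A) :
  category_structure (monoid_of_category X) = structure_of_category X.
Proof.
  unfold category_structure, structure_of_category; simpl; f_equal.
  (* The identity of the rebuilt category is i(1), which functoriality equates with the original
     one. *)
  - extensionality a; exact (fmap_id (incl X) a).
  - extensionality a; extensionality b; extensionality c.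
    extensionality v; extensionality u; exact (under_gamma_in X a b c u v).
Qed.

Theorem corollary2p29 (A : category) :
  exists (Phi : category_under A -> unital_bimodule_monoid A)
         (Psi : unital_bimodule_monoid A -> category_under A),
    (forall X : category_under A,
       structure_of_monoid (Phi X) = hom_structure X) /\
    (forall M : unital_bimodule_monoid A,
       structure_of_category (Psi M) = category_structure M) /\
    (forall X : category_under A, Psi (Phi X) = X) /\
    (forall M : unital_bimodule_monoid A, Phi (Psi M) = M).
Proof.
  exists (@monoid_of_category A), (@category_of_monoid A).
  split; [|split; [|split]].
  - apply structure_of_monoid_of_category.
  - apply structure_of_category_of_monoid.
  - intro X; apply category_under_ext.
    rewrite structure_of_category_of_monoid.
    apply category_structure_monoid_of_category.
  (* The action rebuilt from [eta] has to agree with the given one; the unit laws ensure this. *)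
  - intro M; apply monoid_ext.
    rewrite structure_of_monoid_of_category.
    apply hom_structure_category_of_monoid.
Qed.
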